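(* For each of the following pairs $(p,\beta)$, there exists no infinite word over the ternary alphabet $\{0,1,2\}$ that is $\beta$-free and contains at most $p$ distinct palindromes (the empty word being counted as a palindrome): (a) $(p,\beta)=(4,\beta)$ for any fixed real $\beta\ge 1$; (b) $(p,\beta)=(5,\tfrac{10}{3})$; (c) $(p,\beta)=(15,2)$; (d) $(p,\beta)=(17,\tfrac{41}{22})$.
   Context: An infinite word is a right-infinite sequence of letters. For a nonempty finite word $u$ and a rational $r>1$, a word $v$ is an $r$-power (of $u$) if $v$ is a prefix of the infinite periodic word $uuu\cdots$ and $|v|/|u|=r$. A word is $\beta$-free if none of its factors (contiguous blocks) is an $r$-power with $r\ge\beta$. A palindrome is a finite word equal to its reversal; a word contains a palindrome if the palindrome is one of its factors. The number of palindromes always refers to the number of distinct palindromes, including the empty word. *)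

(* Defs.v *)
From mathcomp Require Import all_boot all_order all_algebra.
From mathcomp Require Import all_classical all_reals.

Set Implicit Arguments.
Unset Strict Implicit.
Unset Printing Implicit Defensive.

Import Order.TTheory GRing.Theory Num.Theory.

Local Open Scope classical_set_scope.
Local Open Scope ring_scope.

Definition infinite_word (T : Type) := nat -> T.

Definition factor_at (T : Type) (w : infinite_word T) (i n : nat) : seq T :=
  mkseq (fun k => w (i + k)%N) n.

Definition factor (T : Type) (v : seq T) (w : infinite_word T) : Prop :=
  exists i n : nat, v = factor_at w i n.

Definition prefix_of (T : Type) (v : seq T) (w : infinite_word T) : Prop :=
  exists n : nat, v = factor_at w 0 n.

(* The word uuu... for u = x :: s; the default value x of nth is never used. *)
Definition periodic_word (T : Type) (x : T) (s : seq T) : infinite_word T :=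
  fun i => nth x (x :: s) (i %% size (x :: s)).

Definition power_of (T : Type) (r : rat) (u v : seq T) : Prop :=
  if u is x :: s then
    prefix_of v (periodic_word x s) /\ (size v)%:R / (size u)%:R = r
  else False.

Definition is_power (T : Type) (r : rat) (v : seq T) : Prop :=
  exists u : seq T, power_of r u v.

Definition power_free (R : realType) (T : Type) (beta : R)
    (w : infinite_word T) : Prop :=
  forall (r : rat) (v : seq T),
    1 < r -> beta <= ratr r -> factor v w -> ~ is_power r v.

Definition palindrome (T : Type) (v : seq T) : Prop := rev v = v.

(* The empty word is a factor of every infinite word and is counted here. *)
Definition palindromes (T : Type) (w : infinite_word T) : set (seq T) :=
  [set v | factor v w /\ palindrome v].

Definition at_most_palindromes (T : Type) (p : nat) (w : infinite_word T) : Prop :=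
  (palindromes w #<= `I_p)%card.

(* Main.v *)
(* Every claim reduces to a finite backtracking search over the words that can
   be prolonged to the right, except that:
   - with at most 3 nonempty palindromes the word must be periodic of period 3,
     hence contains powers of every exponent;
   - in the last case almost all of the search tree lies over the six sets of
     16 palindromes made of the 15 palindromes of length at most 5 without
     repeated adjacent letters (other than ababa) and one palindrome x of the
     form abcacba.  There the infinite words avoiding the other palindromes and
     all long repetitions of small period are eventually periodic of period
     117.  The search becomes small if one first proves, one after the other,
     that well-chosen short words (dead_ends) are not factors, each refutation
     using the previous ones. *)
From mathcomp Require Import all_boot all_order all_algebra.
From mathcomp Require Import all_classical all_reals.
From mathcomp Require Import zify lra.
Require Import Defs.

Set Implicit Arguments.
Unset Strict Implicit.
Unset Printing Implicit Defensive.

Import Order.TTheory GRing.Theory Num.Theory.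

Local Open Scope nat_scope.

(** * Repetitions and palindromes in words over the naturals *)

Section Combinatorics.

Variable w : infinite_word nat.

(* In a repetition of length q + L and period q, the exponent (q + L) / q is at
   least (a + b) / b exactly when a * q <= b * L. *)
Definition repetition_free (a b : nat) : Prop :=
  forall i q L, 0 < q -> 0 < L -> a * q <= b * L ->
    ~ (forall k, k < L -> w (i + k) = w (i + k + q)).

(** The empty palindrome is left out, so the bounds used with these lists are one less than those of
    the theorem. *)
Definition palindrome_list (s : seq (seq nat)) : Prop :=
  uniq s /\
  {in s, forall v, [/\ v != [::], palindrome v & factor v w]}.

Definition palindrome_bound (p : nat) : Prop :=
  forall s, palindrome_list s -> size s <= p.

Lemma drop_factor_at (T : Type) (u : infinite_word T) i m n :
  drop m (factor_at u i n) = factor_at u (i + m) (n - m).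
Proof.
rewrite /factor_at /mkseq -map_drop drop_iota add0n -{1}(addn0 m) iotaDl.
by rewrite -map_comp; apply: eq_map => k /=; rewrite addnA.
Qed.

Lemma take_factor_at (T : Type) (u : infinite_word T) i m n :
  take m (factor_at u i n) = factor_at u i (minn m n).
Proof. by rewrite /factor_at /mkseq -map_take take_iota. Qed.

Lemma factor_infix (s1 s2 s3 : seq nat) :
  factor (s1 ++ s2 ++ s3) w -> factor s2 w.
Proof.
move=> [i [n e]].
have -> : s2 = take (size s2) (drop (size s1) (s1 ++ s2 ++ s3)).
  by rewrite drop_size_cat // take_size_cat.
by rewrite e drop_factor_at take_factor_at; do 2!eexists.
Qed.

(* A finite word is explored from left to right and stored with its last
   letter first, so that its suffixes are prefixes of the stored list. *)
Definition past (i n : nat) : seq nat := rev (factor_at w i n).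

Lemma size_past i n : size (past i n) = n.
Proof. by rewrite size_rev size_mkseq. Qed.

Lemma pastS i n : past i n.+1 = w (i + n) :: past i n.
Proof.
by rewrite /past /factor_at /mkseq -[in LHS]addn1 iotaD map_cat rev_cat.
Qed.

Lemma nth_past i n k : k < n -> nth 0 (past i n) k = w (i + (n - k.+1)).
Proof.
by move=> kn; rewrite nth_rev size_mkseq // nth_mkseq //; lia.
Qed.

Lemma take_past i n l :
  take l (past i n) = rev (factor_at w (i + (n - l)) (minn l n)).
Proof.
rewrite /past take_rev size_mkseq drop_factor_at; congr (rev (factor_at _ _ _)).
lia.
Qed.

(** * Detection of repetitions *)

Fixpoint agrees (L : nat) (s t : seq nat) : bool :=
  if L is L'.+1 then
    if s is x :: s' then
      if t is y :: t' then if eqn x y then agrees L' s' t' else false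
      else false
    else false
  else true.

Lemma agreesP L s t : agrees L s t ->
  L <= size t /\ forall k, k < L -> nth 0 s k = nth 0 t k.
Proof.
elim: L s t => [|L IH] [|x s] [|y t] //=.
case: eqnP => // <- /IH [Lt e]; split=> //.
by case=> [|k] //=; apply: e.
Qed.

(** When called with [t] equal to [v], the period grows by one per step, and only repetitions ending
    at the newest letter are tested. *)
Fixpoint repeats (excess v t : seq nat) : bool :=
  if excess is L :: excess' then
    if t is _ :: t' then
      if agrees L v t' then true else repeats excess' v t'
    else false
  else false.

Lemma repeatsP excess v t : repeats excess v t ->
  exists2 j, j < size excess & agrees (nth 0 excess j) v (drop j.+1 t).
Proof.
elim: excess t => [|L excess IH] [|x t] //=.
case: ifP => [? _|_ /IH [j js ?]]; first by exists 0; rewrite //= drop0.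
by exists j.+1.
Qed.

(* Entry q - 1 is the least L with a * q <= b * L. *)
Definition excesses (a b n : nat) : seq nat :=
  [seq (a * q + b.-1) %/ b | q <- iota 1 n].

Definition never_repeats (excess : seq nat) : Prop :=
  forall i m, repeats excess (past i m) (past i m) = false.

Lemma repetition_free_never_repeats a b n : 0 < a -> 0 < b ->
  repetition_free a b -> never_repeats (excesses a b n).
Proof.
move=> a0 b0 rf i m; apply/negP => /repeatsP [j].
rewrite size_map size_iota => jn.
rewrite (nth_map 0) ?size_iota // nth_iota // add1n.
set L := (_ %/ _) => /agreesP [].
rewrite size_drop size_past => Lm e.
have le : a * j.+1 <= b * L.
  have := ltn_ceil (a * j.+1 + b.-1) b0; rewrite -/L; nia.
have L0 : 0 < L by case: L le {e Lm} => //; nia.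
(* The repetition is the last [j.+1 + L] letters explored; reversed storage turns [k] into
   [L - k.+1]. *)
apply: (rf (i + (m - (j.+1 + L))) j.+1 L) => // k kL.
have := e (L - k.+1); rewrite nth_drop !nth_past; try lia.
move=> /(_ ltac:(lia)) e'.
have -> : i + (m - (j.+1 + L)) + k + j.+1 = i + (m - (L - k.+1).+1) by lia.
rewrite e'; congr w; lia.
Qed.

(** * Backtracking search and its soundness *)

Fixpoint starts (s v : seq nat) : bool :=
  if s is x :: s' then
    if v is y :: v' then if eqn x y then starts s' v' else false else false
  else true.

Lemma startsP s v : starts s v -> s = take (size s) v.
Proof.
elim: s v => [|x s IH] [|y v] //=.
by case: eqnP => // <- /IH {1}->.
Qed.

(** Only palindromes ending at the newest letter are tested, as the others were met earlier. *)
Definition add_palindromes (N : nat) (v : seq nat) (ps : seq (seq nat)) :=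
  foldr (fun l qs =>
    let s := take l v in
    if rev s == s then if s \in qs then qs else s :: qs else qs) ps (iota 1 N).

Lemma add_palindromes_past N i n ps : palindrome_list ps ->
  palindrome_list (add_palindromes N (past i n.+1) ps).
Proof.
rewrite /add_palindromes => pps.
have : {in iota 1 N, forall l, 0 < l} by move=> l; rewrite mem_iota => /andP[].
elim: (iota 1 N) => [|l r IH] //= r0.
have /IH {IH} [] : {in r, forall l, 0 < l}.
  by move=> l' rl; apply: r0; rewrite inE rl orbT.
set qs := foldr _ _ _ => uqs pqs; case: eqP => // pal; case: ifPn => // nqs.
split; first by rewrite /= nqs.
move=> v; rewrite inE => /predU1P [->|]; last exact: pqs.
split=> //.
  rewrite -size_eq0 size_take size_past.
  by rewrite -lt0n; case: ifP => _ //; apply: r0; apply: mem_head.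
by rewrite -pal take_past revK; do 2!eexists.
Qed.

(* Exhaustive search: every way of prolonging the word v to the right, first
   by the letters of start and then arbitrarily, reaches a contradiction.
   Conditionals replace || because vm_compute evaluates both its sides. *)
Fixpoint dies (excess : seq nat) (bad : seq (seq nat)) (N : nat)
    (stop : pred (seq (seq nat))) (fuel : nat) (start v : seq nat)
    (ps : seq (seq nat)) : bool :=
  if fuel is fuel'.+1 then
    all (fun c =>
      let v' := c :: v in
      if repeats excess v' v' then true else
      if has (fun f => starts f v') bad then true else
      let ps' := add_palindromes N v' ps in
      if stop ps' then true else
      dies excess bad N stop fuel' (behead start) v' ps')
    (if start is c :: _ then [:: c] else iota 0 3)
  else false.

Hypothesis letters3 : forall i, w i < 3.

(** The word [w] itself traces a branch that no test cuts, on which the fuel runs out and the result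
    is [false]. *)
Lemma dies_past excess (bad : seq (seq nat)) N (stop : pred (seq (seq nat)))
    fuel start i m ps :
    never_repeats excess ->
    {in bad, forall f, ~ factor (rev f) w} ->
    (forall qs, palindrome_list qs -> ~ stop qs) ->
    (forall j, j < size start -> w (i + m + j) = nth 0 start j) ->
    palindrome_list ps ->
  ~ dies excess bad N stop fuel start (past i m) ps.
Proof.
move=> nrep nbad nstop.
elim: fuel start m ps => [|fuel IH] start m ps hs pps //= /allP alive.
have /alive {alive} :
    w (i + m) \in (if start is c :: _ then [:: c] else iota 0 3).
  case: start hs {alive} => [_|c start /(_ 0 erefl)].
    by rewrite mem_iota letters3.
  by rewrite addn0 inE => ->.
rewrite -pastS nrep.
case: hasP => [[f fbad /startsP ef] _|_].
  apply: (nbad f fbad); rewrite ef take_past revK; do 2!eexists; reflexivity.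
have pps' := add_palindromes_past N i m pps.
case: ifP => [/nstop-/(_ pps') //|_].
apply: IH => // j; rewrite size_behead => js.
rewrite nth_behead -(hs j.+1); last by lia.
by congr w; lia.
Qed.

Lemma dies_factor excess (bad : seq (seq nat)) N (stop : pred (seq (seq nat)))
    fuel u :
    never_repeats excess ->
    {in bad, forall f, ~ factor (rev f) w} ->
    (forall qs, palindrome_list qs -> ~ stop qs) ->
  dies excess bad N stop fuel u [::] [::] -> ~ factor u w.
Proof.
move=> nrep nbad nstop d [i [m e]].
apply: (@dies_past excess bad N stop fuel u i 0 [::]) => // j.
by rewrite e size_mkseq => jm; rewrite nth_mkseq // addn0.
Qed.

(** Palindromes matter here only through the forbidden words [bad], so none is collected. *)
Fixpoint eliminates (excess : seq nat) (bad : seq (seq nat)) (fuel : nat)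
    (us : seq (seq nat)) : bool :=
  if us is u :: us' then
    if dies excess bad 0 pred0 fuel u [::] [::]
    then eliminates excess (rev u :: bad) fuel us' else false
  else dies excess bad 0 pred0 fuel [::] [::] [::].

Lemma eliminatesP excess (bad : seq (seq nat)) fuel us :
    never_repeats excess ->
    {in bad, forall f, ~ factor (rev f) w} ->
  ~ eliminates excess bad fuel us.
Proof.
move=> nrep; elim: us bad => [|u us IH] bad nbad /=.
  by move/dies_factor; apply => //; exists 0, 0.
case: ifP => // /dies_factor du; apply: IH => f; rewrite inE.
by case/predU1P => [->|/nbad //]; rewrite revK; apply: du.
Qed.

(* Unlike those of nat, the literals of Number.uint keep leading zeros. *)
Definition word (d : Number.uint) : seq nat :=
  let fix digits d := match d with
    | Decimal.D0 d' => 0 :: digits d'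
    | Decimal.D1 d' => 1 :: digits d'
    | Decimal.D2 d' => 2 :: digits d'
    | _ => [::] end in
  if d is Number.UIntDecimal d' then digits d' else [::].

Delimit Scope dec_uint_scope with word.

(** * Periodicity, and the exponents 10/3 and 2 *)

Lemma period3_check : all (fun a => all (fun b => all (fun c => all (fun d =>
    (a == d) || dies [::] [::] 4 (fun ps => 3 < size ps) 4
                  [:: a; b; c; d] [::] [::])
  (iota 0 3)) (iota 0 3)) (iota 0 3)) (iota 0 3).
Proof. by vm_compute. Qed.

(** A ternary word of four letters whose ends differ already has four nonempty palindromes. *)
Lemma period3 i : palindrome_bound 3 -> w i = w (i + 3).
Proof.
move=> pb.
have w3 j : w j \in iota 0 3 by rewrite mem_iota letters3.
have /orP [/eqP // | d] :=
  allP (allP (allP (allP period3_check _ (w3 i)) _ (w3 (i + 1)))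
          _ (w3 (i + 2))) _ (w3 (i + 3)).
exfalso; apply: (dies_factor _ _ _ d).
- by move=> j m.
- by move=> f.
- by move=> qs /pb; rewrite leqNgt => /negP.
- by exists i, 4; rewrite /factor_at /mkseq /= addn0.
Qed.

(** Ignoring periods above [n] and palindromes longer than [N] can only keep more branches alive, so
    success stays conclusive. *)
Lemma dies_palindrome_bound a b n N k fuel : 0 < a -> 0 < b ->
    dies (excesses a b n) [::] N (fun ps => k < size ps) fuel
      [::] [::] [::] ->
  repetition_free a b -> ~ palindrome_bound k.
Proof.
move=> a0 b0 d rf pb.
apply: (dies_factor (repetition_free_never_repeats n a0 b0 rf) _ _ d).
- by move=> f.
- by move=> qs /pb; rewrite leqNgt => /negP.
- by exists 0, 0.
Qed.

Lemma search_7_3 :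
  dies (excesses 7 3 30) [::] 20 (fun ps => 4 < size ps) 80 [::] [::] [::].
Proof. by vm_compute. Qed.

Lemma repetition_free_7_3 : repetition_free 7 3 -> ~ palindrome_bound 4.
Proof. exact: (dies_palindrome_bound _ _ search_7_3). Qed.

Lemma search_1_1 :
  dies (excesses 1 1 30) [::] 20 (fun ps => 14 < size ps) 50 [::] [::] [::].
Proof. by vm_compute. Qed.

Lemma repetition_free_1_1 : repetition_free 1 1 -> ~ palindrome_bound 14.
Proof. exact: (dies_palindrome_bound _ _ search_1_1). Qed.

(** * The exponent 41/22 *)

Definition short_palindromes : seq (seq nat) := map word
  [:: 0; 1; 2; 010; 020; 101; 121; 202; 212;
      01210; 02120; 10201; 12021; 20102; 21012]%word.

Definition long_palindromes : seq (seq nat) := map word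
  [:: 0120210; 0210120; 1021201; 1201021; 2012102; 2102012]%word.

(* The minimal palindromes, beyond the short ones and x, that are not excluded
   by repetition-freeness when x is a factor. *)
Definition rivals (x : seq nat) : seq (seq nat) :=
  [seq y <- long_palindromes | y != x] ++
  [seq c :: rcons x c | c <- iota 0 3 & c != head 0 x].

(* Chosen by a greedy computer search for x = 0120210.  As this x begins with
   012, renaming each letter c to nth 0 x c treats any other x. *)
Definition dead_ends : seq (seq nat) := map word
  [:: 0212021020102101210; 0212021020102120210; 1012010201202101210;
      1012010201210120210; 1012021020102101210; 1012021020102120210;
      1012021201020120210; 1012102010210121021; 1012102010212021012;
      01020120212012101202; 01020121012010201202; 01020121012021201020;
      01020121012021201210]%word.

Lemma rivals_check : all (fun x =>
    all (fun y =>
      [&& uniq [:: y, x & short_palindromes], y != [::], rev y == y,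
          x != [::] & rev x == x]) (rivals x)) long_palindromes.
Proof. by vm_compute. Qed.

Lemma eliminates_check : all (fun x => eliminates (excesses 19 22 120)
    (map rev (rivals x)) 250 (map (map (nth 0 x)) dead_ends))
  long_palindromes.
Proof. by vm_compute. Qed.

(** The search forbids the rivals without assuming that [x] occurs, so a rival is found in either
    case. *)
Lemma rival_factor x : repetition_free 19 22 -> x \in long_palindromes ->
  exists2 y, y \in rivals x & factor y w.
Proof.
move=> rf xl; apply: contrapT => norival.
apply: (eliminatesP _ _ (allP eliminates_check x xl)).
  exact: repetition_free_never_repeats.
by move=> _ /mapP [y yr ->]; rewrite revK => fy; apply: norival; exists y.
Qed.

Lemma long_palindrome_check : all (fun x =>
    dies (excesses 19 22 50) [::] 15
      (fun ps => (16 < size ps) || all (fun p => p \in ps) short_palindromes)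
      100 x [::] [::]) long_palindromes.
Proof. by vm_compute. Qed.

Lemma repetition_free_19_22 : repetition_free 19 22 -> ~ palindrome_bound 16.
Proof.
move=> rf pb.
have [[x xl fx]|nolong] :=
  pselect (exists2 x, x \in long_palindromes & factor x w); last first.
  (* Any rival is itself long or extends [x] by a letter on both sides, so some long palindrome
     occurs after all. *)
  have xl : word 0120210%word \in long_palindromes by [].
  have [y] := rival_factor rf xl.
  rewrite mem_cat mem_filter => /orP [/andP [_ yl] fy|/mapP [c _ ->] fy].
    by apply: nolong; exists y.
  apply: nolong; exists (word 0120210%word) => //.
  by apply: (@factor_infix [:: c] _ [:: c]); rewrite cats1.
apply: (dies_factor _ _ _ (allP long_palindrome_check x xl) fx).
- exact: repetition_free_never_repeats.
- by move=> f.
move=> qs pqs /orP[|/allP short]; first by apply/negP; rewrite -leqNgt pb.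
(* Once all 15 short palindromes occur, [x] and a rival bring the number to 17. *)
have [y yr fy] := rival_factor rf xl.
have /and5P [u y0 /eqP py x0 /eqP px] := allP (allP rivals_check x xl) y yr.
suff /pb : palindrome_list [:: y, x & short_palindromes] by [].
split=> // v; rewrite in_cons => /predU1P [->|] //.
rewrite in_cons => /predU1P [->|vs] //.
by apply: pqs.2; apply: short.
Qed.

End Combinatorics.

(** * Transfer from ternary words and conclusion *)

Local Open Scope ring_scope.

(** The block of length [q + L] at [i] would be a power of its first [q] letters with exponent at
    least [beta]. *)
Lemma power_free_nonperiodic (R : realType) (T : Type) (beta : R)
    (w : infinite_word T) (i q L : nat) :
  power_free beta w -> (0 < q)%N -> (0 < L)%N ->
  beta * q%:R <= (q + L)%:R ->
  ~ (forall k, (k < L)%N -> w (i + k)%N = w (i + k + q)%N).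
Proof.
move=> pf q0 L0 le per.
have q0R (K : numFieldType) : 0 < q%:R :> K by rewrite ltr0n.
apply: (pf ((q + L)%:R / q%:R) (factor_at w i (q + L))).
- rewrite ltr_pdivlMr ?q0R // (mul1r q%:R) ltr_nat.
  by rewrite -[X in (X < _)%N]addn0 ltn_add2l.
- by rewrite fmorph_div /= !ratr_nat ler_pdivlMr ?q0R.
- by do 2!eexists.
exists (factor_at w i q).
(* Indices are shifted back by [q] until they fall below [q]. *)
have e k : (k < q + L)%N -> w (i + k)%N = w (i + k %% q)%N.
  elim/ltn_ind: k => k IH kL.
  have [kq|qk] := ltnP k q; first by rewrite modn_small.
  have -> : (i + k = i + (k - q) + q)%N by lia.
  rewrite -per; last by lia.
  rewrite IH; [|lia..]; congr (w (i + _)%N).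
  by rewrite -[in RHS](subnK qk) modnDr.
have sz : size (factor_at w i q) = q by rewrite size_mkseq.
rewrite /power_of; case eu: (factor_at w i q) sz => [|x s] sz.
  by move: q0; rewrite -sz.
rewrite /factor_at size_mkseq sz; split=> //.
exists (q + L)%N; apply/eq_in_map => k; rewrite mem_iota add0n /= => kL.
rewrite /periodic_word sz -eu /factor_at nth_mkseq ?ltn_pmod // add0n.
exact: e.
Qed.

(** Natural numbers let the searches compute without ordinals. *)
Definition letters (w : infinite_word 'I_3) : infinite_word nat :=
  fun i => w i.

Lemma power_free_repetition_free (R : realType) (a b : nat) (beta : R)
    (w : infinite_word 'I_3) :
  (0 < b)%N -> beta * b%:R <= (a + b)%:R ->
  power_free beta w -> repetition_free (letters w) a b.
Proof.
move=> b0 le pf i q L q0 L0 leL per.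
apply: (@power_free_nonperiodic _ _ _ w i q L pf q0 L0) => [|k /per/val_inj //].
have b0R : 0 < b%:R :> R by rewrite ltr0n.
rewrite -(ler_pM2r b0R) mulrAC (le_trans (ler_wpM2r (ler0n _ q) le)) //.
by rewrite -!natrM ler_nat; lia.
Qed.

Lemma palindrome_bound_letters (p : nat) (w : infinite_word 'I_3) :
  at_most_palindromes p.+1 w -> palindrome_bound (letters w) p.
Proof.
move=> few s [us fs].
(* As [inord] undoes [val] on letters, [decode] is injective on the factors of [letters w]. *)
pose decode : seq nat -> seq 'I_3 := map inord.
have decode_factor i n :
    decode (factor_at (letters w) i n) = factor_at w i n.
  by rewrite /decode -map_comp; apply: eq_map => k /=; rewrite inord_val.
have decodeK v : v \in s -> map val (decode v) = v.
  case/fs => _ _ [i [n ->]].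
  by rewrite decode_factor /factor_at -map_comp; apply: eq_map.
have fin : finite_set (palindromes w) by apply/finite_set_leP; exists p.+1.
suff /uniq_leq_size : uniq ([::] :: map decode s) => [le|].
  rewrite -ltnS; apply: leq_trans (geq_card_fset_set few).
  rewrite -(size_map decode); apply: (le _) => v.
  rewrite in_cons in_fset_set // inE => /predU1P [->|].
    by split=> //; exists 0%N, 0%N.
  case/mapP => u su ->; have [_ pu [i [n eu]]] := fs u su; split.
    by rewrite eu decode_factor; exists i, n.
  by rewrite /palindrome -map_rev pu.
rewrite /= map_inj_in_uniq ?us ?andbT.
  apply/mapP => -[u su]; have [u0 _ _] := fs u su.
  by case: u u0 {su}.
by move=> u v su sv e; rewrite -(decodeK u su) e decodeK.
Qed.

Theorem theorem1 (R : realType) :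
  [/\ (forall beta : R, 1 <= beta ->
        ~ exists w : infinite_word 'I_3,
            power_free beta w /\ at_most_palindromes 4 w),
      ~ (exists w : infinite_word 'I_3,
            power_free (10%:R / 3%:R : R) w /\ at_most_palindromes 5 w),
      ~ (exists w : infinite_word 'I_3,
            power_free (2%:R : R) w /\ at_most_palindromes 15 w)
    & ~ (exists w : infinite_word 'I_3,
            power_free (41%:R / 22%:R : R) w /\ at_most_palindromes 17 w)].
Proof.
have letters3 w i : (letters w i < 3)%N by apply: ltn_ord.
split.
- move=> beta beta1 [w [pf /palindrome_bound_letters pb]].
  pose m := Num.bound beta.
  have bm : beta < m%:R by apply: archi_boundP; lra.
  have m0 : (0 < m)%N by rewrite -(ltr0n R); lra.
  (* Period 3 over [3 + 3 * m] letters gives the exponent [m + 1], which exceeds [beta]. *)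
  apply: (@power_free_nonperiodic _ _ _ w 0 3 (3 * m) pf) => [//|||k _].
  + by lia.
  + rewrite natrD natrM; lra.
  + by apply: val_inj; apply: (period3 (letters3 w)).
- move=> [w [pf /palindrome_bound_letters]].
  apply: (repetition_free_7_3 (letters3 w)).
  by apply: power_free_repetition_free pf => //; rewrite divfK ?pnatr_eq0.
- move=> [w [pf /palindrome_bound_letters]].
  apply: (repetition_free_1_1 (letters3 w)).
  by apply: power_free_repetition_free pf => //; rewrite mulr1.
- move=> [w [pf /palindrome_bound_letters]].
  apply: (repetition_free_19_22 (letters3 w)).
  by apply: power_free_repetition_free pf => //; rewrite divfK ?pnatr_eq0.
Qed.
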